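(* Let $X_i,\bar X_i,Y_i\in\mathbb{R}^{n\times T}$, $U_i\in\mathbb{R}^{m\times T}$ be data matrices collected from the (unknown) subsystem, let $Q_{wi}$ be the disturbance-bound matrix, and let $\Psi_i$ be the set of data-consistent parameters $(A_i,B_i,C_i)$ (all defined in the context, together with the standing assumptions). Let $\xi_i^{12}=\xi_i^{21}\in\mathbb{R}$ be a known scalar. Suppose there are matrices $\tilde K_i\in\mathbb{R}^{m\times n}$, $\hat K_i\in\mathbb{R}^{T\times n}$, $\tilde K_{ii},\hat K_{ii}\in\mathbb{R}^{m\times n}$ and scalars $\lambda_{i1},\lambda_{i2},\bar\xi_i^{11},\xi_i^{22},\bar\eta_{ii}^{11},\bar\eta_{ii}^{21},\bar\eta_{ii}^{22}$ such that $X_i\hat K_i$ is symmetric, $X_i\hat K_i>0$, $\bar\xi_i^{11}>0$, $\xi_i^{22}<0$, $\bar\eta_{ii}^{11}>0$, $\bar\eta_{ii}^{22}<0$, $\lambda_{i1}\ge0$, $\lambda_{i2}\ge0$, $Q_{i1}>0$, $$\begin{bmatrix}Q_{i1}&S_{i1}\\ S_{i1}^\top&R_{i1}\end{bmatrix}\ge0\quad\text{and}\quad\begin{bmatrix}Q_{i2}&S_{i2}\\ S_{i2}^\top&R_{i2}\end{bmatrix}\ge0,$$ where, with $\bar Q_{wi}=\begin{bmatrix}\mathbf{I}&\bar X_i\\ \mathbf{0}&-X_i\\ \mathbf{0}&-U_i\end{bmatrix}Q_{wi}\begin{bmatrix}\mathbf{I}&\bar X_i\\ \mathbf{0}&-X_i\\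 \mathbf{0}&-U_i\end{bmatrix}^\top$, $$Q_{i1}=\begin{bmatrix}\mathbf{I}&Y_i\hat K_i&\mathbf{0}\\ \star&X_i\hat K_i&\xi_i^{21}\hat K_i^\top Y_i^\top\\ \star&\star&\bar\xi_i^{11}\mathbf{I}\end{bmatrix},\quad S_{i1}=\begin{bmatrix}\mathbf{0}&\mathbf{0}&\mathbf{0}\\ \mathbf{0}&X_i\hat K_i&\tilde K_i^\top\\ (-\xi_i^{22})\mathbf{I}&\mathbf{0}&\mathbf{0}\end{bmatrix},\quad R_{i1}=\begin{bmatrix}X_i\hat K_i&\mathbf{0}&\mathbf{0}\\ \star&\mathbf{0}&\mathbf{0}\\ \star&\star&\mathbf{0}\end{bmatrix}-\lambda_{i1}\bar Q_{wi},$$ $$Q_{i2}=\begin{bmatrix}-\bar\eta_{ii}^{22}\mathbf{I}&\mathbf{0}\\ \star&\bar\eta_{ii}^{11}\mathbf{I}\end{bmatrix},\quad S_{i2}=\begin{bmatrix}\mathbf{0}&\mathbf{0}&\mathbf{0}&-\bar\eta_{ii}^{22}\mathbf{I}&\mathbf{0}&\mathbf{0}\\ \bar\xi_i^{11}\mathbf{I}&\mathbf{0}&\mathbf{0}&-\xi_i^{21}\mathbf{I}+\bar\eta_{ii}^{21}\mathbf{I}&\mathbf{0}&\mathbf{0}\end{bmatrix},$$ $$R_{i2}=\begin{bmatrix}\bar R_{i2}^{11}&\bar R_{i2}^{12}\\ \star&\bar R_{i2}^{22}\end{bmatrix}-\lambda_{i2}\begin{bmatrix}\bar Q_{wi}&\mathbf{0}\\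 \mathbf{0}&\bar Q_{wi}\end{bmatrix},$$ $$\bar R_{i2}^{11}=\begin{bmatrix}\bar\xi_i^{11}\mathbf{I}&\mathbf{0}&\mathbf{0}\\ \star&\mathbf{0}&\mathbf{0}\\ \star&\star&\mathbf{0}\end{bmatrix},\quad\bar R_{i2}^{12}=\begin{bmatrix}\mathbf{0}&\mathbf{0}&\mathbf{0}\\ \mathbf{0}&\mathbf{0}&\mathbf{0}\\ \tilde K_{ii}&\mathbf{0}&\mathbf{0}\end{bmatrix},\quad\bar R_{i2}^{22}=\begin{bmatrix}\mathbf{I}&\mathbf{0}&-\hat K_{ii}^\top\\ \star&\mathbf{0}&\mathbf{0}\\ \star&\star&\mathbf{0}\end{bmatrix}.$$ Then, with $K_i=\tilde K_i(X_i\hat K_i)^{-1}$ and $\xi_i^{11}=(-\xi_i^{22})^{-1}\bar\xi_i^{11}$, for every $(A_i,B_i,C_i)\in\Psi_i$ the closed-loop subsystem $$x_i(t+1)=(A_i+B_iK_i)x_i(t)+\tilde u_i(t),\qquad y_i(t)=C_ix_i(t)$$ is $\mathcal{X}_i$-dissipative from $\tilde u_i$ to $y_i$, where $\mathcal{X}_i=[\xi_i^{kl}\mathbf{I}]_{k,l\in\{1,2\}}$ with $\xi_i^{11}>0$ and $\xi_i^{22}<0$.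
   Context: Data: a subsystem $x_i(t+1)=A_ix_i(t)+B_iu_i(t)+w_i(t)$, $y_i(t)=C_ix_i(t)$ with $x_i,y_i\in\mathbb{R}^{n}$, $u_i\in\mathbb{R}^{m}$ and unknown parameters produces a trajectory, from which one forms $X_i=[x_i(0),\dots,x_i(T-1)]$, $\bar X_i=[x_i(1),\dots,x_i(T)]$, $U_i=[u_i(0),\dots,u_i(T-1)]$, $Y_i=[y_i(0),\dots,y_i(T-1)]$ (known) and $W_i=[w_i(0),\dots,w_i(T-1)]$ (unknown). Scalar-block assumption: the desired subsystem dissipativity matrix has blocks $\mathcal{X}_i^{kl}=\xi_i^{kl}\mathbf{I}$, with the off-diagonal scalars $\xi_i^{12}=\xi_i^{21}$ prescribed; hence input $\tilde u_i$, state and output all have dimension $n$. The barred scalars $\bar\eta_{ii}^{kl}$ and the matrices $\tilde K_{ii},\hat K_{ii}$ are auxiliary decision variables. Disturbance assumption: $W_i$ satisfies $$\begin{bmatrix}\mathbf{I}\\ W_i^\top\end{bmatrix}^\top Q_{wi}\begin{bmatrix}\mathbf{I}\\ W_i^\top\end{bmatrix}\ge0 \qquad(\ast)$$ where $Q_{wi}=[Q_{wi}^{kl}]_{k,l\in\{1,2\}}\in\mathbb{R}^{(n+T)\times(n+T)}$ is a known symmetric matrix with $Q_{wi}^{22}<0$. Data-richness assumption: $\begin{bmatrix}U_i\\ X_i\end{bmatrix}$ has full row rank $m+n$. $\Psi_i$ is the set of all $(A_i,B_i,C_i)$ for which there exists some $W_i$ satisfying $(\ast)$ with $\bar X_i=A_iX_i+B_iU_i+W_i$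 and $Y_i=C_iX_i$. Matrix inequalities are between symmetric matrices ($>0$ positive definite, $\ge0$ positive semidefinite); $\star$ denotes blocks determined by symmetry. Dissipativity: a discrete-time system $x(t+1)=f(x(t),u(t))$, $y(t)=h(x(t),u(t))$ is $\mathcal{X}$-dissipative from $u$ to $y$, where $\mathcal{X}=\mathcal{X}^\top=[\mathcal{X}^{kl}]_{k,l\in\{1,2\}}$, if there is a storage function $V$ of the state with $V(0)=0$, $V(x)>0$ for all $x\ne 0$, and $$V(x(t+1))-V(x(t))\le\begin{bmatrix}u(t)\\ y(t)\end{bmatrix}^\top\begin{bmatrix}\mathcal{X}^{11}&\mathcal{X}^{12}\\ \mathcal{X}^{21}&\mathcal{X}^{22}\end{bmatrix}\begin{bmatrix}u(t)\\ y(t)\end{bmatrix}$$ for all $t\in\{0,1,2,\dots\}$, all input sequences and all corresponding trajectories. *)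

(* Defs.v *)
From mathcomp Require Export all_boot all_order all_algebra.
From mathcomp Require Export reals.

Set Implicit Arguments.
Unset Strict Implicit.
Unset Printing Implicit Defensive.
Import Order.TTheory GRing.Theory Num.Theory.
Local Open Scope ring_scope.

Section Matrices.
Variable R : realType.

Definition qform n (M : 'M[R]_n) (v : 'cV[R]_n) : R :=
  (v^T *m M *m v) ord0 ord0.

Definition posdefmx n (M : 'M[R]_n) : Prop :=
  M \is symmetricmx /\ forall v : 'cV[R]_n, v != 0 -> 0 < qform M v.

Definition possemidefmx n (M : 'M[R]_n) : Prop :=
  M \is symmetricmx /\ forall v : 'cV[R]_n, 0 <= qform M v.

Definition negdefmx n (M : 'M[R]_n) : Prop := posdefmx (- M).

(* Block matrices; in [sym_block2] and [sym_block3] the blocks below the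
   diagonal are the transposes of the ones above it, but the diagonal blocks
   are not forced to be symmetric. *)
Definition row_mx3 m n1 n2 n3
    (A1 : 'M[R]_(m, n1)) (A2 : 'M[R]_(m, n2)) (A3 : 'M[R]_(m, n3)) :
    'M[R]_(m, n1 + (n2 + n3)) :=
  row_mx A1 (row_mx A2 A3).

Definition block_mx3 m1 m2 m3 n1 n2 n3
    (A11 : 'M[R]_(m1, n1)) (A12 : 'M[R]_(m1, n2)) (A13 : 'M[R]_(m1, n3))
    (A21 : 'M[R]_(m2, n1)) (A22 : 'M[R]_(m2, n2)) (A23 : 'M[R]_(m2, n3))
    (A31 : 'M[R]_(m3, n1)) (A32 : 'M[R]_(m3, n2)) (A33 : 'M[R]_(m3, n3)) :
    'M[R]_(m1 + (m2 + m3), n1 + (n2 + n3)) :=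
  col_mx (row_mx3 A11 A12 A13)
    (col_mx (row_mx3 A21 A22 A23)
            (row_mx3 A31 A32 A33)).

Definition sym_block2 n1 n2
    (A11 : 'M[R]_n1) (A12 : 'M[R]_(n1, n2)) (A22 : 'M[R]_n2) :
    'M[R]_(n1 + n2) :=
  block_mx A11 A12 A12^T A22.

Definition sym_block3 n1 n2 n3
    (A11 : 'M[R]_n1) (A12 : 'M[R]_(n1, n2)) (A13 : 'M[R]_(n1, n3))
    (A22 : 'M[R]_n2) (A23 : 'M[R]_(n2, n3)) (A33 : 'M[R]_n3) :
    'M[R]_(n1 + (n2 + n3)) :=
  block_mx3 A11   A12   A13
            A12^T A22   A23
            A13^T A23^T A33.

End Matrices.

Section Dissipativity.
Variable R : realType.

Definition dissipative n p q
    (f : 'cV[R]_n -> 'cV[R]_p -> 'cV[R]_n)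
    (h : 'cV[R]_n -> 'cV[R]_p -> 'cV[R]_q) (XX : 'M[R]_(p + q)) : Prop :=
  XX \is symmetricmx /\
  exists V : 'cV[R]_n -> R,
    [/\ V 0 = 0,
        forall x, x != 0 -> 0 < V x
      & forall (u : nat -> 'cV[R]_p) (x : nat -> 'cV[R]_n)
               (y : nat -> 'cV[R]_q),
          (forall t, x t.+1 = f (x t) (u t)) ->
          (forall t, y t = h (x t) (u t)) ->
          forall t, V (x t.+1) - V (x t) <= qform XX (col_mx (u t) (y t))].

End Dissipativity.

Section Data.
Variables (R : realType) (n m T : nat).

Definition snapshots k (z : nat -> 'cV[R]_k) : 'M[R]_(k, T) :=
  \matrix_(i < k, t < T) z t i ord0.

(* Only the samples x(0), ..., x(T) and u(t), w(t), y(t) for t < T of the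
   sequences below are constrained. *)
Definition generates
    (A : 'M[R]_n) (B : 'M[R]_(n, m)) (C : 'M[R]_n)
    (X Xbar : 'M[R]_(n, T)) (U : 'M[R]_(m, T)) (W Y : 'M[R]_(n, T)) : Prop :=
  exists (x : nat -> 'cV[R]_n) (u : nat -> 'cV[R]_m)
         (w y : nat -> 'cV[R]_n),
    (forall t, (t < T)%N ->
       x t.+1 = A *m x t + B *m u t + w t /\ y t = C *m x t) /\
    [/\ X = snapshots x, Xbar = snapshots (fun t => x t.+1),
        U = snapshots u, W = snapshots w & Y = snapshots y].

Definition disturbance_bound (Qw : 'M[R]_(n + T)) (W : 'M[R]_(n, T)) : Prop :=
  possemidefmx ((col_mx 1%:M W^T)^T *m Qw *m col_mx 1%:M W^T).

Definition Psi (Qw : 'M[R]_(n + T))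
    (X Xbar : 'M[R]_(n, T)) (U : 'M[R]_(m, T)) (Y : 'M[R]_(n, T))
    (A : 'M[R]_n) (B : 'M[R]_(n, m)) (C : 'M[R]_n) : Prop :=
  exists W : 'M[R]_(n, T),
    [/\ disturbance_bound Qw W,
        Xbar = A *m X + B *m U + W
      & Y = C *m X].

End Data.

Section LMI.
Variables (R : realType) (n m T : nat).
Implicit Types (X Xbar Y : 'M[R]_(n, T)) (U : 'M[R]_(m, T)).

Definition Qwbar (Qw : 'M[R]_(n + T)) X Xbar U : 'M[R]_(n + (n + m)) :=
  let G : 'M[R]_(n + (n + m), n + T) :=
    col_mx (row_mx 1%:M Xbar)
      (col_mx (row_mx 0 (- X))
              (row_mx 0 (- U))) in
  G *m Qw *m G^T.

Definition Q1 X Y (Khat : 'M[R]_(T, n)) (xi21 xib11 : R) :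
    'M[R]_(n + (n + n)) :=
  sym_block3 1%:M (Y *m Khat) 0
                  (X *m Khat) (xi21 *: (Khat^T *m Y^T))
                              (xib11%:M).

Definition S1 X (Kt : 'M[R]_(m, n)) (Khat : 'M[R]_(T, n)) (xi22 : R) :
    'M[R]_(n + (n + n), n + (n + m)) :=
  block_mx3 0               0            0
            0               (X *m Khat)  (Kt^T)
            ((- xi22)%:M)   0            0.

Definition R1 (Qw : 'M[R]_(n + T)) X Xbar U (Khat : 'M[R]_(T, n))
    (lambda1 : R) : 'M[R]_(n + (n + m)) :=
  sym_block3 (X *m Khat) 0 0
                         0 0
                           0
  - lambda1 *: Qwbar Qw X Xbar U.

Definition Q2 (etab11 etab22 : R) : 'M[R]_(n + n) :=
  sym_block2 ((- etab22)%:M) 0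
                             (etab11%:M).

Definition S2 (xi21 xib11 etab21 etab22 : R) :
    'M[R]_(n + n, (n + (n + m)) + (n + (n + m))) :=
  block_mx (row_mx3 0         0 0) (row_mx3 (- etab22)%:M         0 0)
           (row_mx3 xib11%:M  0 0) (row_mx3 (- xi21 + etab21)%:M  0 0).

Definition Rbar2_11 (xib11 : R) : 'M[R]_(n + (n + m)) :=
  sym_block3 (xib11%:M) 0 0
                        0 0
                          0.

Definition Rbar2_12 (Ktii : 'M[R]_(m, n)) : 'M[R]_(n + (n + m)) :=
  block_mx3 0    0 0
            0    0 0
            Ktii 0 0.

Definition Rbar2_22 (Khatii : 'M[R]_(m, n)) : 'M[R]_(n + (n + m)) :=
  sym_block3 1%:M 0 (- Khatii^T)
                  0 0
                    0.

Definition R2 (Qw : 'M[R]_(n + T)) X Xbar U (Ktii Khatii : 'M[R]_(m, n))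
    (xib11 lambda2 : R) : 'M[R]_((n + (n + m)) + (n + (n + m))) :=
  sym_block2 (Rbar2_11 xib11) (Rbar2_12 Ktii)
                              (Rbar2_22 Khatii)
  - lambda2 *: sym_block2 (Qwbar Qw X Xbar U) 0
                                              (Qwbar Qw X Xbar U).

End LMI.

(* Main.v *)
(* Evaluate the first LMI at the vectors [(a, b, c, v, A^T v, B^T v)].  Since
   [I A B] maps the columns of [I Xbar; 0 -X; 0 -U] to [I W], the multiplier
   term is [lambda1] times a form that is nonnegative by the disturbance bound,
   and can be dropped.  With [P = X Khat], [p = - xi22] and [F = A + B K], what
   remains is
     |a|^2 + 2 a^T C P b + b^T P b + 2 xi21 b^T P C^T c + xib11 |c|^2
       + 2 b^T P F^T v + 2 p c^T v + v^T P v >= 0.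
   The choice [a = - C x], [b = P^-1 x], [c = p^-1 u], [v = - P^-1 (F x + u)]
   turns [p] times this inequality into the dissipation inequality for the
   storage function [V x = p x^T P^-1 x]. *)
Require Import Defs.
From mathcomp Require Import all_boot all_order all_algebra.
From mathcomp Require Import reals.
From mathcomp Require Import ring.
Set Implicit Arguments.
Unset Strict Implicit.
Unset Printing Implicit Defensive.
Import Order.TTheory GRing.Theory Num.Theory.
Local Open Scope ring_scope.

Definition bform (R : realType) m n (M : 'M[R]_(m, n)) (x : 'cV[R]_m)
  (y : 'cV[R]_n) : R := (x^T *m M *m y) ord0 ord0.

Section BilinearForms.
Variable R : realType.

Lemma qformE n (M : 'M[R]_n) x : qform M x = bform M x x.
Proof. by []. Qed.

Lemma bform_tr m n (M : 'M[R]_(m, n)) x y : bform M^T x y = bform M y x.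
Proof.
rewrite /bform; suff -> : y^T *m M *m x = (x^T *m M^T *m y)^T by rewrite [RHS]mxE.
by rewrite !trmx_mul !trmxK mulmxA.
Qed.

Lemma bform_mulmxl m n k (M : 'M[R]_(m, n)) (A : 'M[R]_(m, k)) x y :
  bform M (A *m x) y = bform (A^T *m M) x y.
Proof. by rewrite /bform trmx_mul !mulmxA. Qed.

Lemma bform_mulmxr m n k (M : 'M[R]_(m, n)) (A : 'M[R]_(n, k)) x y :
  bform M x (A *m y) = bform (M *m A) x y.
Proof. by rewrite /bform !mulmxA. Qed.

Lemma bformDr m n (M : 'M[R]_(m, n)) x y z :
  bform M x (y + z) = bform M x y + bform M x z.
Proof. by rewrite /bform mulmxDr mxE. Qed.

Lemma bformNl m n (M : 'M[R]_(m, n)) x z : bform M (- x) z = - bform M x z.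
Proof. by rewrite /bform linearN /= !mulNmx mxE. Qed.

Lemma bformNr m n (M : 'M[R]_(m, n)) x z : bform M x (- z) = - bform M x z.
Proof. by rewrite /bform mulmxN mxE. Qed.

Lemma bformZl m n (M : 'M[R]_(m, n)) a x z :
  bform M (a *: x) z = a * bform M x z.
Proof. by rewrite /bform linearZ /= -!scalemxAl mxE. Qed.

Lemma bformZr m n (M : 'M[R]_(m, n)) a x z :
  bform M x (a *: z) = a * bform M x z.
Proof. by rewrite /bform -scalemxAr mxE. Qed.

Lemma bform0 m n x y : bform (0 : 'M[R]_(m, n)) x y = 0.
Proof. by rewrite /bform mulmx0 mul0mx mxE. Qed.

Lemma bformDm m n (M N : 'M[R]_(m, n)) x y :
  bform (M + N) x y = bform M x y + bform N x y.
Proof. by rewrite /bform mulmxDr mulmxDl mxE. Qed.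

Lemma bformB m n (M N : 'M[R]_(m, n)) x y :
  bform (M - N) x y = bform M x y - bform N x y.
Proof. by rewrite /bform mulmxBr mulmxBl !mxE. Qed.

Lemma bform_scale m n a (M : 'M[R]_(m, n)) x y :
  bform (a *: M) x y = a * bform M x y.
Proof. by rewrite /bform -scalemxAr -scalemxAl mxE. Qed.

Lemma bform_scalar n a (x y : 'cV[R]_n) :
  bform a%:M x y = a * bform 1%:M x y.
Proof. by rewrite -(scalemx1 _ a) bform_scale. Qed.

Lemma bform_col_mx m1 m2 n (M1 : 'M[R]_(m1, n)) (M2 : 'M[R]_(m2, n)) x1 x2 y :
  bform (col_mx M1 M2) (col_mx x1 x2) y = bform M1 x1 y + bform M2 x2 y.
Proof. by rewrite /bform tr_col_mx mul_row_col mulmxDl mxE. Qed.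

Lemma bform_row_mx m n1 n2 (M1 : 'M[R]_(m, n1)) (M2 : 'M[R]_(m, n2)) x y1 y2 :
  bform (row_mx M1 M2) x (col_mx y1 y2) = bform M1 x y1 + bform M2 x y2.
Proof. by rewrite /bform mul_mx_row mul_row_col mxE. Qed.

Lemma bform_block_mx m1 m2 n1 n2 (M11 : 'M[R]_(m1, n1)) (M12 : 'M[R]_(m1, n2))
    (M21 : 'M[R]_(m2, n1)) (M22 : 'M[R]_(m2, n2)) x1 x2 y1 y2 :
  bform (block_mx M11 M12 M21 M22) (col_mx x1 x2) (col_mx y1 y2) =
  bform M11 x1 y1 + bform M12 x1 y2 + (bform M21 x2 y1 + bform M22 x2 y2).
Proof. by rewrite /block_mx bform_col_mx !bform_row_mx. Qed.

(** [bform_scalar] stays out of this list: its right-hand side contains the scalar matrix [1%:M], so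
    repeated rewriting with it would not stop. *)
Definition bformE :=
  (bform_block_mx, bform_col_mx, bform_row_mx, bform_tr, bform0, bformB,
   bform_scale).

Lemma symmetricmxE n (M : 'M[R]_n) : (M \is symmetricmx) = (M == M^T).
Proof. by rewrite is_hermitianmxE expr0 scale1r map_mx_id. Qed.

Lemma bform_symC n (M : 'M[R]_n) x y :
  M \is symmetricmx -> bform M x y = bform M y x.
Proof. by rewrite symmetricmxE => /eqP symM; rewrite [in LHS]symM bform_tr. Qed.

(** A nonzero row vector in the left kernel would, once transposed, make the quadratic form
    vanish. *)
Lemma posdefmx_unit n (M : 'M[R]_n) : posdefmx M -> M \in unitmx.
Proof.
move=> [_ posM]; rewrite -row_free_unit -kermx_eq0.
apply/negPn/negP=> /rowV0Pn[v /sub_kermxP vM0 vN0].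
have := posM v^T; rewrite trmx_eq0 => /(_ vN0).
by rewrite /qform trmxK vM0 mul0mx mxE ltxx.
Qed.

Lemma invmx_sym n (M : 'M[R]_n) : M \is symmetricmx -> invmx M \is symmetricmx.
Proof. by rewrite !symmetricmxE trmx_inv => /eqP <-. Qed.

(** Substitute [y = M^-1 x]: then [x^T M^-1 x = y^T M y]. *)
Lemma invmx_posdef n (M : 'M[R]_n) : posdefmx M -> posdefmx (invmx M).
Proof.
move=> pdM; have uM := posdefmx_unit pdM; have [symM posM] := pdM.
split=> [|x xN0]; first by apply: invmx_sym.
have yN0 : invmx M *m x != 0.
  by apply: contra_neq xN0 => /(congr1 (mulmx M)); rewrite mulKVmx ?mulmx0.
have := posM _ yN0; rewrite !qformE bform_mulmxr mulmxV // bform_mulmxl.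
by rewrite mulmx1 bform_tr.
Qed.

End BilinearForms.

(** Transposing the data equation gives [Xbar^T v - X^T A^T v - U^T B^T v = W^T v]. Hence the outer
    factor of [Qwbar] carries this vector to [(v, W^T v)], where the disturbance bound applies. *)
Lemma Psi_multiplier_ge0 (R : realType) n m T (Qw : 'M[R]_(n + T))
    (X Xbar Y : 'M[R]_(n, T)) (U : 'M[R]_(m, T)) A B C v :
  Psi Qw X Xbar U Y A B C ->
  0 <= bform (Qwbar Qw X Xbar U) (col_mx v (col_mx (A^T *m v) (B^T *m v)))
             (col_mx v (col_mx (A^T *m v) (B^T *m v))).
Proof.
move=> [W [[_ /(_ v)]]]; rewrite qformE => W_ge0 XbarE _.
rewrite /Qwbar -bform_mulmxr -[G in G *m Qw]trmxK -bform_mulmxl.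
set G := (X in X^T *m _).
suff -> : G^T *m col_mx v (col_mx (A^T *m v) (B^T *m v)) = col_mx 1%:M W^T *m v.
  by rewrite bform_mulmxl bform_mulmxr.
rewrite /G !tr_col_mx !tr_row_mx !trmx1 !trmx0 !mul_row_col !mul_col_mx !mul0mx.
rewrite !add_col_mx !addr0 mul1mx; congr col_mx.
have -> : W = Xbar - (A *m X + B *m U) by rewrite XbarE addrC addKr.
rewrite linearB linearD /= !linearN /= !trmx_mul mulmxBl mulmxDl !mulNmx.
by rewrite !mulmxA opprD.
Qed.

Theorem proposition7 (R : realType) (n m T : nat)
  (X Xbar Y : 'M[R]_(n, T)) (U : 'M[R]_(m, T)) (Qw : 'M[R]_(n + T))
  (* the data come from an unknown true subsystem *)
  (A0 : 'M[R]_n) (B0 : 'M[R]_(n, m)) (C0 : 'M[R]_n) (W0 : 'M[R]_(n, T))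
  (hdata : generates A0 B0 C0 X Xbar U W0 Y)
  (* disturbance assumption *)
  (hQw_sym : Qw \is symmetricmx)
  (hQw22 : negdefmx (drsubmx Qw))
  (hW0 : disturbance_bound Qw W0)
  (* data richness *)
  (hrich : row_free (col_mx U X))
  (* prescribed off-diagonal scalars *)
  (xi12 xi21 : R) (hxi : xi12 = xi21)
  (* decision variables *)
  (Kt : 'M[R]_(m, n)) (Khat : 'M[R]_(T, n)) (Ktii Khatii : 'M[R]_(m, n))
  (lambda1 lambda2 xib11 xi22 etab11 etab21 etab22 : R)
  (hXK_sym : X *m Khat \is symmetricmx)
  (hXK : posdefmx (X *m Khat))
  (hxib11 : 0 < xib11) (hxi22 : xi22 < 0)
  (hetab11 : 0 < etab11) (hetab22 : etab22 < 0)
  (hlambda1 : 0 <= lambda1) (hlambda2 : 0 <= lambda2)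
  (hQ1 : posdefmx (Q1 X Y Khat xi21 xib11))
  (hLMI1 : possemidefmx
     (sym_block2 (Q1 X Y Khat xi21 xib11) (S1 X Kt Khat xi22)
                                          (R1 Qw X Xbar U Khat lambda1)))
  (hLMI2 : possemidefmx
     (sym_block2 (Q2 n etab11 etab22) (S2 n m xi21 xib11 etab21 etab22)
                             (R2 Qw X Xbar U Ktii Khatii xib11 lambda2))) :
  let K : 'M[R]_(m, n) := Kt *m invmx (X *m Khat) in
  let xi11 : R := (- xi22)^-1 * xib11 in
  [/\ 0 < xi11, xi22 < 0
    & forall (A : 'M[R]_n) (B : 'M[R]_(n, m)) (C : 'M[R]_n),
        Psi Qw X Xbar U Y A B C ->
        dissipative (fun x ut : 'cV[R]_n => (A + B *m K) *m x + ut)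
                    (fun x ut : 'cV[R]_n => C *m x)
                    (block_mx xi11%:M xi12%:M xi21%:M xi22%:M)].

Proof.
move=> K xi11; have p_gt0 : 0 < - xi22 by rewrite oppr_gt0.
split=> // [|A B C ABC]; first by rewrite mulr_gt0 ?invr_gt0.
rewrite {}/K {}/xi11; set P := X *m Khat in hXK hXK_sym hLMI1 *.
set K := Kt *m invmx P.
have uP : P \in unitmx by exact: posdefmx_unit.
have pdZ := invmx_posdef hXK.
have trZ : (invmx P)^T = invmx P.
  by have [+ _] := pdZ; rewrite symmetricmxE => /eqP <-.
split; first by rewrite symmetricmxE tr_block_mx !tr_scalar_mx hxi.
exists (fun x => - xi22 * bform (invmx P) x x); split.
- by rewrite /bform mulmx0 mxE mulr0.
- by move=> x xN0; rewrite mulr_gt0 //; have [_] := pdZ; apply.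
move=> u x y xE yE t; rewrite xE yE {xE yE}.
move: (x t) (u t) => {u x y t} x u.
set F : 'M[R]_n := A + B *m K; set w : 'cV[R]_n := F *m x + u.
(* The output equation [Y = C X] brings the unknown [C] into the LMI. *)
have YKhat : Y *m Khat = C *m P by have [W [_ _ ->]] := ABC; rewrite -mulmxA.
(* This [v] minimises [2 w^T v + v^T P v], with minimum [- w^T P^-1 w]: the storage at the next
   state, up to the factor [xi22]. It is known only through [vE], so the block expansion treats it
   as atomic. *)
have [v vE] : {v : 'cV[R]_n | v = - (invmx P *m w)} by eexists.
pose z := col_mx v (col_mx (A^T *m v) (B^T *m v)).
have mult_ge0 : 0 <= lambda1 * bform (Qwbar Qw X Xbar U) z z.
  by rewrite mulr_ge0 // (Psi_multiplier_ge0 v ABC).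
(* The entry [- C x] minimises [|a|^2 + 2 a^T C x]; the minimum [- |C x|^2], multiplied by [- xi22],
   is the output term of the supply rate. *)
have [_ /(_ (col_mx (col_mx (- (C *m x))
  (col_mx (invmx P *m x) ((- xi22)^-1 *: u))) z))] := hLMI1.
rewrite qformE /sym_block2 /Q1 /S1 /R1 /sym_block3 /block_mx3 /row_mx3 -/P YKhat.
rewrite -trmx_mul YKhat; rewrite /z in mult_ge0 *; rewrite !bformE.
have CPZ s : bform (C *m P) s (invmx P *m x) = bform 1%:M s (C *m x).
  by rewrite !bform_mulmxr mulmxK // mul1mx.
have PZZ s : bform P (invmx P *m s) (invmx P *m s) = bform (invmx P) s s.
  by rewrite bform_mulmxr mulmxV // bform_mulmxl mulmx1 bform_tr.
(* Since [Kt P^-1 = K], the two terms merge into [v^T (A + B K) x]. *)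
have PF : bform P (invmx P *m x) (A^T *m v) + bform Kt (B^T *m v) (invmx P *m x)
    = - bform (invmx P) w (F *m x).
  rewrite (bform_symC _ _ hXK_sym) !bform_mulmxl !bform_mulmxr !trmxK mulmxK //.
  rewrite -mulmxA -bformDm -/F vE bformNl.
  by rewrite bform_mulmxl trZ.
have ZFw : bform (invmx P) w w =
    bform (invmx P) w (F *m x) + bform (invmx P) w u.
  by rewrite -bformDr.
have uv : bform 1%:M u v = - bform (invmx P) w u.
  by rewrite vE bformNr bform_mulmxr mul1mx -bform_tr trZ.
have PvE : bform P v v = bform (invmx P) w w.
  by rewrite vE bformNl bformNr opprK PZZ.
have Cxu : bform 1%:M (C *m x) u = bform 1%:M u (C *m x).
  by rewrite -bform_tr trmx1.
rewrite !CPZ PF !PZZ PvE !bformNl !bformNr !bformZl.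
rewrite !(bform_scalar (- xi22)) !(bform_scalar xib11) uv bformZr.
rewrite qformE bform_block_mx !(bform_scalar (_ * _)).
rewrite !(bform_scalar xi12) !(bform_scalar xi21) !(bform_scalar xi22).
rewrite Cxu ZFw hxi => LMI.
rewrite -subr_ge0.
(* Adding [mult_ge0] cancels the multiplier term of [LMI]; only a field identity is left. *)
have := mulr_ge0 (ltW p_gt0) (addr_ge0 mult_ge0 LMI); congr (is_true (0 <= _)).
have xi22N0 : xi22 != 0 by rewrite lt_eqF.
by field.
Qed.
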